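(* The integral equation $$G(x) = \int_{-x}^\infty (1+G(y))\,e^{-G(y)}\, dy \qquad (x\in\mathbb{R})$$ has a unique solution; that is, there is exactly one function $G:\mathbb{R}\to\mathbb{R}$ such that for every $x\in\mathbb{R}$ the integral on the right-hand side converges and equals $G(x)$. *)

(* Defs.v *)
From Stdlib Require Import Reals.
From Coquelicot Require Import Coquelicot.
Open Scope R_scope.

(* The integral over [-x, oo) is the improper Riemann integral: [is_RInt_gen]
   asserts both that the integrals over [-x, T] exist for all large T and that
   they converge to [G x] as T tends to infinity. *)
Definition solves_integral_equation (G : R -> R) : Prop :=
  forall x : R,
    is_RInt_gen (fun y : R => (1 + G y) * exp (- G y))
      (at_point (- x)) (Rbar_locally p_infty) (G x).

(* Main.v *)
Require Import Defs.
From Stdlib Require Import Reals Lra Ranalysis5 ClassicalEpsilon FunctionalExtensionality.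
From Coquelicot Require Import Coquelicot.
Open Scope R_scope.

(** Write [weight u = (1 + u) exp (- u)] and [energy u = (2 + u) exp (- u)], so
    that [energy' = - weight].

    Differentiating the integral equation gives [G' x = weight (G (- x))], with
    [G] tending to 0 at minus infinity, and the equation follows back from these
    two facts ([solution_ode], [ode_solution]).  The pair [(G x, G (- x))] is
    thus a trajectory of the planar Hamiltonian system [g' = weight h],
    [h' = - weight g] with Hamiltonian [energy g + energy h].  Since [G] tends
    to 0 on the left it grows at least linearly on the right, and the value of
    the invariant is [energy 0 + 0 = 2] ([ode_energy]).

    Uniqueness.  The level set [energy g + energy h = 2] has a component in the
    open positive quadrant, and it meets the boundary of that quadrant nowhere:
    there one coordinate is 0, which forces the other one to have energy 0, hence
    to be -2.  The trajectory is in the quadrant for large times, so it stays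
    there and [G > 0] ([ode_pos]).  At time 0 the invariant reads
    [energy (G 0) = 1], which has only one positive root, and as [weight] is
    Lipschitz on the nonnegative reals, two trajectories with the same value at
    0 agree by a Gronwall estimate ([ode_unique]).

    Existence ([ode_exists]).  The component of the level set is parametrized by
    [s] in (-1, 1) through [energy g = 1 - s], [energy h = 1 + s].  If [A] is the
    inverse of [1 - energy] on the positive reals, this says [g = A s],
    [h = A (- s)], and the system becomes [s' = weight (A s) * weight (A (- s))].
    The right-hand side is even in [s], so the time [Theta s] needed to go from 0
    to [s] is odd; it satisfies [Theta s >= A s - A 0] for [s >= 0], hence it is a
    bijection from (-1, 1) to the real line.  The solution is [A] composed with
    the inverse of [Theta]. *)

(** * Inverse functions and monotonicity *)

(** The inverse is described on the image of the interval, in the form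
    [g (f x) = x]: surjectivity onto a given range is a separate question, and
    it is the place where the behaviour of [f] at the endpoints enters. *)
Lemma inverse_function (a b : Rbar) (f df : R -> R) :
  (forall x : R, Rbar_lt a x -> Rbar_lt x b -> is_derive f x (df x)) ->
  (forall x : R, Rbar_lt a x -> Rbar_lt x b -> 0 < df x) ->
  exists g : R -> R, forall x : R, Rbar_lt a x -> Rbar_lt x b ->
    g (f x) = x /\ is_derive g (f x) (/ df x).
Proof.
  intros Hf Hdf.
  assert (Hinc : forall x y : R, Rbar_lt a x -> x < y -> Rbar_lt y b -> f x < f y)
    by (apply incr_function with df; assumption).
  assert (Hcont : forall x : R, Rbar_lt a x -> Rbar_lt x b -> continuity_pt f x).
  { intros x Hax Hxb. apply derivable_continuous_pt. exists (df x).
    now apply is_derive_Reals, Hf. }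
  set (g := fun y => epsilon (inhabits 0)
                       (fun x : R => (Rbar_lt a x /\ Rbar_lt x b) /\ f x = y)).
  assert (Hg : forall x : R, Rbar_lt a x -> Rbar_lt x b -> g (f x) = x).
  { intros x Hax Hxb.
    destruct (epsilon_spec (inhabits 0)
      (fun z : R => (Rbar_lt a z /\ Rbar_lt z b) /\ f z = f x)) as [[Ha Hb] He].
    - now exists x.
    - fold (g (f x)) in Ha, Hb, He.
      destruct (Rtotal_order (g (f x)) x) as [H | [H | H]]; [ | exact H | ].
      + generalize (Hinc _ _ Ha H Hxb); lra.
      + generalize (Hinc _ _ Hax H Hb); lra. }
  exists g. intros x Hax Hxb. split; [now apply Hg | ].
  (* A compact neighbourhood of [x] inside the interval, on which the
     closed-interval inverse function theorems apply. *)
  assert (Hsub : exists x1 x2 : R, x1 < x < x2 /\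
            forall z, x1 <= z <= x2 -> Rbar_lt a z /\ Rbar_lt z b).
  { destruct (open_and _ _ (open_Rbar_gt a) (open_Rbar_lt b) x (conj Hax Hxb))
      as [eps Heps].
    exists (x - eps / 2), (x + eps / 2).
    generalize (cond_pos eps); intros He. split; [lra | ].
    intros z Hz. apply Heps. apply Rabs_def1; unfold minus, plus, opp; simpl; lra. }
  destruct Hsub as (x1 & x2 & Hx & Hsub).
  assert (H12 : x1 <= x1 <= x2 /\ x1 <= x <= x2 /\ x1 <= x2 <= x2) by lra.
  destruct H12 as (H1 & H0 & H2).
  apply Hsub in H1, H2.
  assert (Hlt1 : f x1 < f x) by (apply Hinc; tauto || lra).
  assert (Hlt2 : f x < f x2) by (apply Hinc; tauto || lra).
  assert (Hsurj : forall y, f x1 <= y <= f x2 -> x1 <= g y <= x2 /\ f (g y) = y).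
  { intros y Hy.
    destruct (f_interv_is_interv f x1 x2 y) as (z & Hz & <-); [lra | exact Hy | | ].
    - intros z Hz. apply Hcont; now apply Hsub.
    - rewrite Hg; [now split | now apply Hsub | now apply Hsub]. }
  assert (Hgc : continuity_pt g (f x)).
  { apply continuity_pt_recip_interv with f x1 x2.
    - lra.
    - intros u v Hu Huv Hv. apply Hinc; [apply Hsub; lra | lra | apply Hsub; lra].
    - intros y Hy1 Hy2. now apply Hsurj.
    - intros y Hy1 Hy2. now apply Hsurj.
    - intros z Hz. apply Hcont; now apply Hsub.
    - lra. }
  assert (Prf : forall z, g (f x1) <= z <= g (f x2) -> derivable_pt f z).
  { intros z. rewrite !Hg by tauto. intros Hz. exists (df z).
    apply is_derive_Reals, Hf; now apply Hsub. }
  assert (Hmid : g (f x1) <= g (f x) <= g (f x2)) by (rewrite !Hg by tauto; lra).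
  assert (Hd : derive_pt f (g (f x)) (Prf (g (f x)) Hmid) = df x).
  { apply derive_pt_eq_0. rewrite Hg by assumption.
    now apply is_derive_Reals, Hf. }
  generalize (Hdf x Hax Hxb); intros Hpos.
  replace (/ df x) with (1 / derive_pt f (g (f x)) (Prf (g (f x)) Hmid))
    by (rewrite Hd; field; lra).
  apply is_derive_Reals.
  apply derivable_pt_lim_recip_interv with (f x1) (f x2); try lra.
  - exact Hgc.
  - intros y Hy. now apply Hsurj.
Qed.

Lemma is_derive_continuous (f : R -> R) (x d : R) : is_derive f x d -> continuous f x.
Proof. intros H. apply (ex_derive_continuous f x). now exists d. Qed.

Lemma nondecreasing_of_derive (f df : R -> R) (a b : R) :
  a <= b ->
  (forall x : R, a <= x <= b -> is_derive f x (df x)) ->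
  (forall x : R, a <= x <= b -> 0 <= df x) ->
  f a <= f b.
Proof.
  intros Hab Hf Hdf.
  destruct (MVT_gen f a b df) as (c & Hc & He);
    rewrite ?Rmin_left, ?Rmax_right in * by exact Hab.
  - intros x Hx. apply Hf. lra.
  - intros x Hx. apply continuity_pt_filterlim, is_derive_continuous with (df x). now apply Hf.
  - generalize (Hdf c Hc); nra.
Qed.

(** * The weight and the energy *)

Definition weight (u : R) : R := (1 + u) * exp (- u).
Definition energy (u : R) : R := (2 + u) * exp (- u).

Lemma weight_pos (u : R) : 0 <= u -> 0 < weight u.
Proof. intros Hu. apply Rmult_lt_0_compat; [lra | apply exp_pos]. Qed.

Lemma weight_le_1 (u : R) : weight u <= 1.
Proof.
  unfold weight. rewrite exp_Ropp.
  apply Rmult_le_reg_r with (exp u); [apply exp_pos | ].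
  rewrite Rmult_assoc, Rinv_l by (apply Rgt_not_eq, exp_pos).
  generalize (exp_ineq1_le u); lra.
Qed.

Lemma is_derive_energy (u : R) : is_derive energy u (- weight u).
Proof. unfold energy, weight. auto_derive; [trivial | ring]. Qed.

Lemma is_derive_weight (u : R) : is_derive weight u (- u * exp (- u)).
Proof. unfold weight. auto_derive; [trivial | ring]. Qed.

Lemma continuous_weight (u : R) : continuous weight u.
Proof. apply is_derive_continuous with (1 := is_derive_weight u). Qed.

(** [weight' c = - c exp (- c)], which is at most 1 in absolute value for [c >= 0]
    because [weight c <= 1]. *)
Lemma weight_lipschitz (u v : R) :
  0 <= u -> 0 <= v -> Rabs (weight u - weight v) <= Rabs (u - v).
Proof.
  intros Hu Hv.
  destruct (MVT_gen weight v u (fun z => - z * exp (- z))) as (c & Hc & ->).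
  - intros z _. apply is_derive_weight.
  - intros z _. apply continuity_pt_filterlim, continuous_weight.
  - assert (Hc0 : 0 <= c).
    { apply Rle_trans with (2 := proj1 Hc). now apply Rmin_glb. }
    rewrite Rabs_mult. rewrite <- (Rmult_1_l (Rabs (u - v))) at 2.
    apply Rmult_le_compat_r; [apply Rabs_pos | ].
    generalize (weight_le_1 c) (exp_pos (- c)); unfold weight; intros H1 H2.
    apply Rabs_le. nra.
Qed.

Lemma energy_pos (u : R) : -2 < u -> 0 < energy u.
Proof. intros Hu. apply Rmult_lt_0_compat; [lra | apply exp_pos]. Qed.

Lemma energy_decreasing (u v : R) : -1 < u -> u < v -> energy v < energy u.
Proof.
  intros Hu Huv.
  apply Ropp_lt_cancel.
  apply (incr_function (fun z => - energy z) (-1) p_infty weight); simpl; trivial.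
  - intros z _ _. rewrite <- (Ropp_involutive (weight z)).
    apply (is_derive_opp energy), is_derive_energy.
  - intros z Hz _. apply Rmult_lt_0_compat; [lra | apply exp_pos].
Qed.

Lemma energy_0 : energy 0 = 2.
Proof. unfold energy. rewrite Ropp_0, exp_0. ring. Qed.

(** From [exp u = exp (u / 2) ^ 2 >= (1 + u / 2) ^ 2]. *)
Lemma energy_bound (u : R) : -2 < u -> energy u <= 4 / (2 + u).
Proof.
  intros Hu. unfold energy. rewrite exp_Ropp.
  assert (Hexp : exp u = exp (u / 2) * exp (u / 2)) by (rewrite <- exp_plus; f_equal; field).
  generalize (exp_ineq1_le (u / 2)) (exp_pos u); intros H Hp.
  apply Rmult_le_reg_r with (exp u * (2 + u)); [nra | ].
  replace ((2 + u) * / exp u * (exp u * (2 + u))) with ((2 + u) * (2 + u)) by (field; lra).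
  replace (4 / (2 + u) * (exp u * (2 + u))) with (4 * exp u) by (field; lra).
  rewrite Hexp. nra.
Qed.

Lemma is_lim_energy : is_lim energy p_infty 0.
Proof.
  apply is_lim_le_le_loc with (f := fun _ => 0) (g := fun u => 4 / (2 + u)).
  - exists 0. intros u Hu. split.
    + apply Rlt_le, energy_pos. lra.
    + apply energy_bound. lra.
  - apply is_lim_const.
  - apply is_lim_spec. intros eps. exists (4 / eps). intros u Hu.
    generalize (cond_pos eps); intros He.
    assert (0 < 4 / eps) by (apply Rdiv_lt_0_compat; lra).
    rewrite Rminus_0_r, Rabs_pos_eq by (apply Rlt_le, Rdiv_lt_0_compat; lra).
    apply Rlt_div_l; [lra | ].
    apply Rlt_div_l in Hu; [ | lra]. nra.
Qed.

(** * The integral equation as a differential equation *)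

Definition mirror_ode (G : R -> R) : Prop :=
  forall x : R, is_derive G x (weight (G (- x))).

(** The eta-expanded form is the one that [auto_derive] leaves. *)
Lemma Derive_ode (G : R -> R) (x : R) :
  mirror_ode G -> Derive (fun y : R => G y) x = weight (G (- x)).
Proof. intros Hode. apply is_derive_unique, Hode. Qed.

(** Convergence of the improper integrals gives integrability on every segment,
    and the increment is the difference of two tails. *)
Lemma solution_increment (G : R -> R) (a b : R) :
  solves_integral_equation G ->
  is_RInt (fun y => weight (G y)) a b (G (- a) - G (- b)).
Proof.
  intros HG.
  assert (Htail : forall c : R,
    is_RInt_gen (fun y => weight (G y)) (at_point c) (Rbar_locally p_infty) (G (- c))).
  { intros c. generalize (HG (- c)). now rewrite Ropp_involutive. }
  assert (Hle : forall c d : R, c <= d -> ex_RInt (fun y => weight (G y)) c d).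
  { intros c d Hcd.
    destruct (Htail c (fun _ => True) filter_true) as [P Q HP [M HM] HPQ].
    destruct (HPQ c (Rmax d M + 1) HP) as (I & HI & _).
    - apply HM. generalize (Rmax_r d M); lra.
    - apply (@ex_RInt_Chasles_1 R_CompleteNormedModule _ c d (Rmax d M + 1)).
      + generalize (Rmax_l d M); lra.
      + now exists I. }
  assert (Hex : ex_RInt (fun y => weight (G y)) a b).
  { destruct (Rle_dec a b) as [H | H]; [now apply Hle | ].
    apply ex_RInt_swap, Hle; lra. }
  destruct Hex as [I HI]. change R in (type of I).
  assert (Hgen : is_RInt_gen (fun y => weight (G y)) (at_point a)
                   (Rbar_locally p_infty) (plus I (G (- b)))).
  { apply (@is_RInt_gen_Chasles R_NormedModule) with b;
      try typeclasses eauto; [now apply is_RInt_gen_at_point | apply Htail]. }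
  generalize (@is_RInt_gen_unique R_CompleteNormedModule _ _ _ _ _ _ Hgen)
    (@is_RInt_gen_unique R_CompleteNormedModule _ _ _ _ _ _ (Htail a)).
  intros -> Hsum.
  replace (G (- a) - G (- b)) with I; [exact HI | ].
  rewrite <- Hsum. change (I = I + G (- b) - G (- b)). ring.
Qed.

(** A solution is an integral of its own weight, so it is continuous; then the
    integrand is continuous, and the fundamental theorem of calculus applies.  The
    limit 0 says that the tails of a convergent integral vanish. *)
Lemma solution_ode (G : R -> R) :
  solves_integral_equation G -> mirror_ode G /\ is_lim G m_infty 0.
Proof.
  intros HG.
  assert (HI : forall x : R, is_RInt (fun y => weight (G y)) 0 x (G 0 - G (- x))).
  { intros x. rewrite <- Ropp_0 at 2. now apply solution_increment. }
  assert (Hback : forall x : R, G 0 - (G 0 - G (- (- x))) = G x).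
  { intros x. rewrite Ropp_involutive. ring. }
  assert (Hcont : forall x : R, continuous G x).
  { intros x.
    apply continuous_ext with (fun x => G 0 - (G 0 - G (- (- x)))); [exact Hback | ].
    apply (continuous_minus (fun _ => G 0)); [apply continuous_const | ].
    apply (continuous_comp Ropp (fun z => G 0 - G (- z))).
    - apply (continuous_opp (fun z : R => z)), continuous_id.
    - apply continuous_RInt_1 with (fun y => weight (G y)) 0.
      now apply filter_forall. }
  split.
  - intros x.
    assert (Hd : is_derive (fun z => G 0 - G (- z)) (- x) (weight (G (- x)))).
    { apply (is_derive_RInt (fun y => weight (G y)) _ 0).
      - now apply filter_forall.
      - apply (continuous_comp G weight); [apply Hcont | apply continuous_weight]. }
    apply is_derive_ext with (fun x => G 0 - (G 0 - G (- (- x)))); [exact Hback | ].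
    evar_last.
    + apply (is_derive_minus (fun _ => G 0) (fun x => G 0 - G (- (- x)))).
      * apply is_derive_const.
      * apply (is_derive_comp (fun z => G 0 - G (- z)) Ropp); [exact Hd | ].
        apply (is_derive_opp (fun z : R => z)), is_derive_id.
    + unfold minus, plus, opp, scal, zero, one; simpl; unfold mult; simpl. ring.
  - apply is_lim_spec. intros eps.
    generalize (HG 0). rewrite Ropp_0. intros H0.
    destruct (H0 (ball (G 0) eps) (locally_ball _ _)) as [P Q HP [M HM] HPQ].
    exists (- M). intros x Hx.
    destruct (HPQ 0 (- x) HP) as (I & HI' & Hball); [apply HM; lra | ].
    simpl in HI'.
    assert (HIx : I = G 0 - G x).
    { rewrite <- (Ropp_involutive x).
      rewrite <- (@is_RInt_unique R_CompleteNormedModule _ _ _ _ (HI (- x))).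
      symmetry. now apply (@is_RInt_unique R_CompleteNormedModule). }
    rewrite HIx in Hball.
    replace (G x - 0) with (- ((G 0 - G x) - G 0)) by ring.
    rewrite Rabs_Ropp. exact Hball.
Qed.

(** The function [- G (- y)] is a primitive of [weight (G y)], so the integral from
    [- x] to [b] is [G x - G (- b)]. *)
Lemma ode_solution (G : R -> R) :
  mirror_ode G -> is_lim G m_infty 0 -> solves_integral_equation G.
Proof.
  intros Hode Hlim x.
  apply filterlimi_locally. intros eps.
  apply is_lim_spec in Hlim. destruct (Hlim eps) as [M HM].
  exists (fun y => y = - x) (fun y => - M < y); [reflexivity | now exists (- M) | ].
  intros a b -> Hb. exists (G x - G (- b)). split.
  - simpl.
    replace (G x - G (- b)) with (minus (- G (- b)) (- G (- (- x))))
      by (rewrite Ropp_involutive; unfold minus, plus, opp; simpl; ring).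
    apply (is_RInt_derive (fun y => - G (- y)) (fun y => weight (G y))).
    + intros y _. auto_derive.
      * eexists; apply Hode.
      * rewrite (Derive_ode _ (- y) Hode), Ropp_involutive. ring.
    + intros y _. apply (continuous_comp G weight); [ | apply continuous_weight].
      apply is_derive_continuous with (weight (G (- y))). apply Hode.
  - specialize (HM (- b)). rewrite Rminus_0_r in HM.
    unfold ball; simpl; unfold AbsRing_ball, abs, minus, plus, opp; simpl.
    replace (G x - G (- b) + - G x) with (- G (- b)) by ring.
    rewrite Rabs_Ropp. apply HM. lra.
Qed.

(** * The invariant and positivity *)

(** Far to the right, [G (- x)] is close to 0 and so [G' x] is close to
    [weight 0 = 1]. *)
Lemma ode_lim_infty (G : R -> R) :
  mirror_ode G -> is_lim G m_infty 0 -> is_lim G p_infty p_infty.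
Proof.
  intros Hode Hlim.
  assert (Hw : is_lim (fun x => weight (G x)) m_infty 1).
  { replace 1 with (weight 0) by (unfold weight; rewrite Ropp_0, exp_0; ring).
    apply filterlim_comp with (2 := continuous_weight 0). exact Hlim. }
  apply is_lim_spec in Hw.
  destruct (Hw (mkposreal (1 / 2) ltac:(lra))) as [M HM]; simpl in HM.
  set (a := 1 - M).
  assert (Hgrow : forall x : R, a <= x -> G a - a / 2 <= G x - x / 2).
  { intros x Hx.
    apply (nondecreasing_of_derive (fun y => G y - y / 2)
             (fun y => weight (G (- y)) - / 2)); [exact Hx | | ].
    - intros y _. apply (is_derive_minus G (fun y => y / 2)); [apply Hode | ].
      auto_derive; [trivial | field].
    - intros y Hy. unfold a in Hy.
      assert (Hy' : - y < M) by lra.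
      generalize (Rabs_def2 _ _ (HM _ Hy')); lra. }
  apply is_lim_spec. intros B.
  exists (Rmax a (2 * (B - G a) + a)). intros x Hx.
  generalize (Rmax_l a (2 * (B - G a) + a)) (Rmax_r a (2 * (B - G a) + a)).
  intros H1 H2. assert (Ha : a <= x) by lra. generalize (Hgrow x Ha); lra.
Qed.

(** Conservation of the Hamiltonian; its value is read off at plus infinity, where
    [G x] is infinite and [G (- x)] vanishes. *)
Lemma ode_energy (G : R -> R) (x : R) :
  mirror_ode G -> is_lim G m_infty 0 -> energy (G x) + energy (G (- x)) = 2.
Proof.
  intros Hode Hlim.
  set (E := fun y => energy (G y) + energy (G (- y))).
  assert (HE : forall y : R, is_derive E y 0).
  { intros y. unfold E. evar_last.
    - apply (is_derive_plus (fun y => energy (G y)) (fun y => energy (G (- y)))).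
      + apply (is_derive_comp energy G); [apply is_derive_energy | apply Hode].
      + apply (is_derive_comp energy (fun y => G (- y))); [apply is_derive_energy | ].
        apply (is_derive_comp G Ropp); [apply Hode | ].
        apply (is_derive_opp (fun z : R => z)), is_derive_id.
    - unfold plus, opp, scal, one; simpl; unfold mult; simpl.
      rewrite Ropp_involutive. ring. }
  assert (Hconst : forall y : R, E y = E x).
  { intros y. destruct (MVT_gen E x y (fun _ => 0)) as (c & _ & Hc).
    - intros z _. apply HE.
    - intros z _. apply continuity_pt_filterlim, is_derive_continuous with 0.
      apply HE.
    - lra. }
  assert (HlimE : is_lim E p_infty (0 + 2)).
  { apply is_lim_plus'.
    - apply filterlim_comp with (2 := is_lim_energy). now apply ode_lim_infty.
    - rewrite <- energy_0.
      apply filterlim_comp with (G := locally 0) (f := fun y => G (- y)).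
      + apply filterlim_comp with (2 := Hlim). apply (filterlim_Rbar_opp p_infty).
      + exact (is_derive_continuous _ _ _ (is_derive_energy 0)). }
  assert (HlimC : is_lim E p_infty (E x)).
  { apply is_lim_ext with (fun _ => E x); [now intros y | apply is_lim_const]. }
  apply is_lim_unique in HlimE, HlimC.
  rewrite HlimE in HlimC. injection HlimC. unfold E. lra.
Qed.

(** Restricted to the trajectory, the smaller of the two coordinates never
    vanishes: if it is 0, the other one is nonnegative, so of positive energy, and
    the total energy exceeds [energy 0 = 2].  It is positive at large times, hence
    everywhere by the intermediate value theorem. *)
Lemma ode_pos (G : R -> R) (x : R) :
  mirror_ode G -> is_lim G m_infty 0 -> 0 < G x.
Proof.
  intros Hode Hlim.
  assert (Hcont : forall y : R, continuous G y).
  { intros y. apply is_derive_continuous with (weight (G (- y))). apply Hode. }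
  set (m := fun y => Rmin (G y) (G (- y))).
  assert (Hm : forall y : R, continuity_pt m y).
  { intros y. apply continuity_pt_filterlim.
    apply (continuous_ext (fun y => (G y + G (- y) - Rabs (G y - G (- y))) * / 2)).
    (* The minimum of [p] and [q] is [(p + q - |p - q|) / 2]. *)
    - intros z. unfold m, Rmin, Rabs. destruct Rle_dec; destruct Rcase_abs; lra.
    - assert (Hc' : continuous (fun y => G (- y)) y).
      { apply (continuous_comp Ropp G); [ | apply Hcont].
        apply (continuous_opp (fun z : R => z)), continuous_id. }
      apply (continuous_mult (fun y => G y + G (- y) - Rabs (G y - G (- y))));
        [ | apply continuous_const].
      apply (continuous_minus (fun y => G y + G (- y))).
      + now apply (continuous_plus G).
      + apply (continuous_comp (fun y => G y - G (- y)) Rabs); [ | apply continuous_Rabs].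
        now apply (continuous_minus G). }
  assert (Hnz : forall y : R, m y <> 0).
  { intros y. generalize (ode_energy G y Hode Hlim). unfold m, Rmin.
    destruct Rle_dec as [H | H]; intros HE H0; rewrite H0 in *; rewrite energy_0 in HE.
    - generalize (energy_pos (G (- y))); lra.
    - generalize (energy_pos (G y)); lra. }
  assert (Hend : exists T : R, x < T /\ 0 < m T).
  { generalize (ode_lim_infty G Hode Hlim); intros Hinf.
    apply is_lim_spec in Hinf, Hlim.
    destruct (Hinf 0) as [M1 HM1].
    destruct (Hlim (mkposreal 1 Rlt_0_1)) as [M2 HM2]; simpl in HM2.
    exists (Rmax x (Rmax M1 (- M2)) + 1).
    generalize (Rmax_l x (Rmax M1 (- M2))) (Rmax_r x (Rmax M1 (- M2)))
      (Rmax_l M1 (- M2)) (Rmax_r M1 (- M2)).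
    set (T := Rmax x (Rmax M1 (- M2)) + 1).
    intros H1 H2 H3 H4. split; [unfold T; lra | ].
    assert (HT : 0 < G T) by (apply HM1; unfold T; lra).
    assert (HT' : Rabs (G (- T) - 0) < 1) by (apply HM2; unfold T; lra).
    apply Rabs_def2 in HT'.
    apply Rmin_glb_lt; [exact HT | ].
    assert (HE : energy (G T) + energy (G (- T)) = 2).
    { apply ode_energy; [exact Hode | now apply is_lim_spec]. }
    generalize (energy_pos (G T)); intros Hp.
    destruct (Rtotal_order (G (- T)) 0) as [H | [H | H]]; [ | | exact H].
    - generalize (energy_decreasing (G (- T)) 0). rewrite energy_0. lra.
    - rewrite H, energy_0 in HE. lra. }
  destruct Hend as (T & HxT & HT).
  apply Rlt_le_trans with (m x); [ | apply Rmin_l].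
  destruct (Rlt_le_dec 0 (m x)) as [H | H]; [exact H | exfalso].
  destruct (f_interv_is_interv m x T 0) as (z & _ & Hz); [lra | lra | auto | ].
  now apply (Hnz z).
Qed.

(** * Uniqueness *)

(** Gronwall estimate for the squared distance [D] between the trajectories
    [(G x, G (- x))]: the Lipschitz bound gives [D' <= 2 D], so
    [D y * exp (- 2 y)] is nonincreasing and stays at its initial value 0.  The
    second coordinate covers negative times. *)
Lemma ode_unique (G1 G2 : R -> R) (x : R) :
  mirror_ode G1 -> mirror_ode G2 ->
  (forall y : R, 0 <= G1 y) -> (forall y : R, 0 <= G2 y) ->
  G1 0 = G2 0 -> G1 x = G2 x.
Proof.
  intros Hode1 Hode2 Hp1 Hp2 H0.
  set (D := fun y => (G1 y - G2 y) ^ 2 + (G1 (- y) - G2 (- y)) ^ 2).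
  set (D' := fun y =>
    2 * (G1 y - G2 y) * (weight (G1 (- y)) - weight (G2 (- y))) -
    2 * (G1 (- y) - G2 (- y)) * (weight (G1 y) - weight (G2 y))).
  assert (HD : forall y : R, 0 <= y -> D y <= 0).
  { intros y Hy.
    assert (H : - (D 0 * exp (- 2 * 0)) <= - (D y * exp (- 2 * y))).
    { apply (nondecreasing_of_derive (fun y => - (D y * exp (- 2 * y)))
               (fun y => (2 * D y - D' y) * exp (- 2 * y))); [exact Hy | | ].
      - intros z _. unfold D, D'. auto_derive.
        + repeat split; try (eexists; apply Hode1); eexists; apply Hode2.
        + rewrite (Derive_ode _ (- z) Hode1), (Derive_ode _ z Hode1).
          rewrite (Derive_ode _ (- z) Hode2), (Derive_ode _ z Hode2).
          rewrite Ropp_involutive. ring.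
      - intros z _. apply Rmult_le_pos; [ | apply Rlt_le, exp_pos].
        generalize (weight_lipschitz _ _ (Hp1 z) (Hp2 z))
          (weight_lipschitz _ _ (Hp1 (- z)) (Hp2 (- z))).
        unfold D, D'.
        generalize (weight (G1 z) - weight (G2 z)) (weight (G1 (- z)) - weight (G2 (- z))).
        generalize (G1 z - G2 z) (G1 (- z) - G2 (- z)).
        intros p q wp wq Hwp Hwq.
        assert (Hbound : forall u v w : R, Rabs w <= Rabs v -> u * w <= (u ^ 2 + v ^ 2) / 2).
        { intros u v w Hw. apply Rsqr_le_abs_1 in Hw. unfold Rsqr in Hw.
          generalize (pow2_ge_0 (u - w)); nra. }
        generalize (Hbound p q wq Hwq) (Hbound (- q) p wp Hwp). nra. }
    unfold D at 1 in H. rewrite Ropp_0, H0 in H.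
    generalize (exp_pos (- 2 * y)); intros He.
    apply Rmult_le_reg_r with (exp (- 2 * y)); [exact He | ].
    lra. }
  assert (HG : forall y : R, 0 <= y -> G1 y = G2 y /\ G1 (- y) = G2 (- y)).
  { intros y Hy. specialize (HD y Hy). unfold D in HD.
    generalize (pow2_ge_0 (G1 y - G2 y)) (pow2_ge_0 (G1 (- y) - G2 (- y))); intros Hsq1 Hsq2.
    split; apply Rminus_diag_uniq, Rsqr_0_uniq; rewrite Rsqr_pow2; lra. }
  destruct (Rle_dec 0 x) as [Hx | Hx].
  - now apply HG.
  - rewrite <- (Ropp_involutive x). apply HG. lra.
Qed.

(** * Existence *)

Lemma energy_inverse :
  exists A : R -> R,
    (forall u : R, 0 < u -> A (1 - energy u) = u) /\
    (forall s : R, -1 < s < 1 ->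
       0 < A s /\ energy (A s) = 1 - s /\ is_derive A s (/ weight (A s))).
Proof.
  assert (Hd : forall u : R, is_derive (fun u => 1 - energy u) u (weight u)).
  { intros u. evar_last.
    - apply (is_derive_minus (fun _ => 1) energy);
        [apply is_derive_const | apply is_derive_energy].
    - unfold minus, plus, opp, zero; simpl. ring. }
  destruct (inverse_function 0 p_infty (fun u => 1 - energy u) weight) as [A HA].
  - intros u _ _. apply Hd.
  - simpl. intros u Hu _. now apply weight_pos, Rlt_le.
  - exists A. split.
    + intros u Hu. now apply HA.
    + intros s Hs.
      destruct (IVT_Rbar_incr (fun u => 1 - energy u) 0 p_infty (1 - 2) (1 - 0) s)
        as (u & Hu & _ & <-).
      * rewrite <- energy_0.
        apply (is_lim_continuity (fun u => 1 - energy u) 0).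
        apply continuity_pt_filterlim, is_derive_continuous with (1 := Hd 0).
      * apply is_lim_minus'; [apply is_lim_const | apply is_lim_energy].
      * intros u _ _. apply continuity_pt_filterlim, is_derive_continuous with (1 := Hd u).
      * exact I.
      * simpl. lra.
      * simpl in Hu. destruct (HA u Hu I) as [HAu HdA].
        rewrite HAu. split; [exact Hu | split; [ring | exact HdA]].
Qed.

(** Time is recovered from the parameter [s] by integrating its inverse speed [q];
    the inverse of the resulting bijection [Theta] gives back the trajectory. *)
Lemma ode_exists :
  exists G : R -> R, mirror_ode G /\ is_lim G m_infty 0.
Proof.
  destruct energy_inverse as (A & HAe & HA).
  assert (Hopp : forall s : R, -1 < s < 1 -> -1 < - s < 1) by (intros; lra).
  assert (HApos : forall s : R, -1 < s < 1 -> 0 < weight (A s)).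
  { intros s Hs. apply weight_pos, Rlt_le, HA, Hs. }
  assert (HAc : forall s : R, -1 < s < 1 -> continuous A s).
  { intros s Hs. apply is_derive_continuous with (/ weight (A s)). now apply HA. }
  set (q := fun s => / (weight (A s) * weight (A (- s)))).
  assert (Hqpos : forall s : R, -1 < s < 1 -> 0 < q s).
  { intros s Hs. apply Rinv_0_lt_compat, Rmult_lt_0_compat; auto. }
  assert (Hqc : forall s : R, -1 < s < 1 -> continuous q s).
  { intros s Hs.
    apply (continuous_comp (fun s => weight (A s) * weight (A (- s))) Rinv).
    - apply (continuous_mult (fun s => weight (A s)) (fun s => weight (A (- s)))).
      + apply (continuous_comp A weight); [auto | apply continuous_weight].
      + apply (continuous_comp (fun s => A (- s)) weight); [ | apply continuous_weight].
        apply (continuous_comp Ropp A); [ | auto].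
        apply (continuous_opp (fun z : R => z)), continuous_id.
    - apply continuous_Rinv, Rgt_not_eq, Rmult_lt_0_compat; auto. }
  set (Theta := fun s => RInt q 0 s).
  assert (HqI : forall s : R, -1 < s < 1 -> is_RInt q 0 s (Theta s)).
  { intros s Hs. apply (@RInt_correct R_CompleteNormedModule).
    apply (@ex_RInt_continuous R_CompleteNormedModule). intros z Hz. apply Hqc.
    revert Hz. unfold Rmin, Rmax. destruct Rle_dec; lra. }
  assert (HTheta : forall s : R, -1 < s < 1 -> is_derive Theta s (q s)).
  { intros s Hs. apply (is_derive_RInt q Theta 0); [ | now apply Hqc].
    generalize (open_and _ _ (open_gt (-1)) (open_lt 1) s Hs).
    apply filter_imp. exact HqI. }
  assert (Hodd : forall s : R, -1 < s < 1 -> Theta (- s) = - Theta s).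
  { intros s Hs.
    apply (@is_RInt_unique R_CompleteNormedModule q 0 (- s) (- Theta s)).
    apply is_RInt_ext with (fun y => opp (opp (q (- y)))).
    - intros y _. rewrite opp_opp. unfold q. rewrite Ropp_involutive, Rmult_comm. reflexivity.
    - apply (@is_RInt_opp R_NormedModule (fun y => opp (q (- y))) 0 (- s) (Theta s)).
      apply (@is_RInt_comp_opp R_NormedModule). rewrite Ropp_0, Ropp_involutive.
      now apply HqI. }
  assert (Hlarge : forall y : R, 0 <= y -> exists s : R, 0 < s < 1 /\ y <= Theta s).
  { intros y Hy.
    assert (H0 : -1 < 0 < 1) by lra.
    destruct (HA 0 H0) as (HA0 & HE0 & _).
    (* The speed of [s] is at most [weight (A s)], since the other factor is at
       most 1; hence [Theta' >= A'] and [Theta] diverges at 1 as [A] does.  The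
       summand 1 makes [u > A 0], that is, the parameter of [u] positive. *)
    set (u := y + 1 + A 0).
    assert (Hu : energy u < 1).
    { replace 1 with (energy (A 0)) by lra. apply energy_decreasing; unfold u; lra. }
    assert (Hu0 : 0 < energy u) by (apply energy_pos; unfold u; lra).
    exists (1 - energy u). split; [lra | ].
    assert (Hcmp : Theta 0 - A 0 <= Theta (1 - energy u) - A (1 - energy u)).
    { apply (nondecreasing_of_derive (fun s => Theta s - A s)
               (fun s => q s - / weight (A s))); [lra | | ].
      - intros s Hs. assert (Hs' : -1 < s < 1) by lra.
        apply (is_derive_minus Theta A); [now apply HTheta | now apply HA].
      - intros s Hs. assert (Hs' : -1 < s < 1) by lra.
        unfold q. apply -> Rminus_le_0. apply Rinv_le_contravar.
        + apply Rmult_lt_0_compat; auto.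
        + generalize (HApos s Hs') (weight_le_1 (A (- s))); nra. }
    rewrite HAe in Hcmp by (unfold u; lra).
    replace (Theta 0) with 0 in Hcmp by (symmetry; apply (RInt_point 0 q)).
    unfold u at 2 in Hcmp. lra. }
  assert (Hsurj : forall x : R, exists s : R, -1 < s < 1 /\ Theta s = x).
  { intros x. destruct (Hlarge (Rabs x) (Rabs_pos x)) as (s & Hs & Hxs).
    destruct (f_interv_is_interv Theta (- s) s x) as (z & Hz & Hzx).
    - lra.
    - rewrite Hodd by lra. apply Rabs_le_between. exact Hxs.
    - intros z Hz. apply continuity_pt_filterlim, is_derive_continuous with (q z).
      apply HTheta. lra.
    - exists z. split; [lra | exact Hzx]. }
  destruct (inverse_function (-1) 1 Theta q) as [S HS].
  { simpl. auto. }
  { simpl. auto. }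
  simpl in HS.
  exists (fun x => A (S x)). split.
  - intros x. destruct (Hsurj x) as (s & Hs & <-).
    rewrite <- Hodd by exact Hs.
    destruct (HS s) as [HSs HdS]; try apply Hs.
    destruct (HS (- s)) as [HSs' _]; try apply Hopp, Hs.
    rewrite HSs'. evar_last.
    + apply (is_derive_comp A S); [ | exact HdS]. rewrite HSs. now apply HA.
    + unfold scal; simpl; unfold mult; simpl. unfold q. field.
      split; apply Rgt_not_eq, HApos; auto.
  - apply is_lim_spec. intros eps. generalize (cond_pos eps); intros He.
    set (s0 := 1 - energy eps).
    assert (Hs0 : -1 < s0 < 1).
    { generalize (energy_pos eps) (energy_decreasing 0 eps). rewrite energy_0.
      unfold s0. lra. }
    exists (Theta s0). intros x Hx.
    destruct (Hsurj x) as (s & Hs & <-).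
    destruct (HS s) as [-> _]; try apply Hs.
    assert (Hlt : s < s0).
    { apply Rnot_le_lt. intros Hle. apply (Rlt_not_le _ _ Hx).
      apply (nondecreasing_of_derive Theta q); [exact Hle | | ].
      - intros z Hz. apply HTheta. lra.
      - intros z Hz. apply Rlt_le, Hqpos. lra. }
    destruct (HA s Hs) as (HAs & HE & _).
    rewrite Rminus_0_r, Rabs_pos_eq by lra.
    apply Rnot_le_lt. intros Hle.
    assert (HEle : energy (A s) <= energy eps).
    { destruct Hle as [Hle | Hle]; [ | rewrite <- Hle; apply Rle_refl].
      apply Rlt_le, energy_decreasing; lra. }
    unfold s0 in Hlt. lra.
Qed.

Theorem proposition2p1 :
  exists! G : R -> R, solves_integral_equation G.
Proof.
  destruct ode_exists as (G & Hode & Hlim).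
  exists G. split; [now apply ode_solution | ].
  intros G' HG'. destruct (solution_ode G' HG') as [Hode' Hlim'].
  assert (Hpos : forall y : R, 0 < G y) by (intros; now apply ode_pos).
  assert (Hpos' : forall y : R, 0 < G' y) by (intros; now apply ode_pos).
  apply functional_extensionality. intros x.
  apply ode_unique; auto using Rlt_le.
  generalize (ode_energy G 0 Hode Hlim) (ode_energy G' 0 Hode' Hlim').
  rewrite Ropp_0. intros HE HE'.
  generalize (Hpos 0) (Hpos' 0); intros H H'.
  destruct (Rtotal_order (G 0) (G' 0)) as [Hlt | [Heq | Hgt]]; [ | exact Heq | ].
  - generalize (energy_decreasing (G 0) (G' 0)); lra.
  - generalize (energy_decreasing (G' 0) (G 0)); lra.
Qed.
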